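(* Let $p=Y_i\bowtie Y_j\in\left[\frac12,\frac23\right]$ be any proper active X-point in the system $\Xi_3(x):=[0,x,1]$ with the property that $t:=\tau(p)\geqslant5$ ($t$ being odd), and let $(y_n)_{n=t}^\infty$ be the normal form orbit of order $t$. On a side of $p$ where $Y_i<Y_j$ we have, near $p$, $$Y_n(x)=[Y_j(x)-Y_i(x)]\,y_n+Y_i(x)$$ for every $n\geqslant t$. In particular, $(Y_n)_{n=t}^\infty$ stabilises (near $p$ on that side) if and only if $(y_n)_{n=t}^\infty$ stabilises.
   Context: Functional mean-median map for $[0,x,1]$: $Y_1(x)=0$, $Y_2(x)=x$, $Y_3(x)=1$, $\Xi_n=[Y_1,\ldots,Y_n]$ (a multiset of functions), and for $n\geqslant3$, $Y_{n+1}=(n+1)\mathcal{M}_n-n\langle\Xi_n\rangle$, where $\mathcal{M}_n=\mathcal{M}(\Xi_n)$ is the pointwise median and $\langle\Xi_n\rangle$ the pointwise mean. The transit time $\tau(x)$ is the least $\tau$ with $Y_{\tau+k}(x)=Y_\tau(x)$ for all $k\in\mathbb{N}$ ($\infty$ if none), and $m(x)=\lim_nY_n(x)$. A sequence stabilises if it is eventually constant. If $(p-\epsilon,p+\epsilon)\cap\{x\in\mathbb{Q}:Y_i(x)=Y_j(x)\}=\{p\}$ for some $\epsilon>0$, $p\in\mathbb{Q}$, we write $p=Y_i\bowtie Y_j$ and call $p$ an X-point; it is stabilising if $\tau(p)<\infty$ and monotonic if the median sequence is monotonic near $p$ (here assumed non-decreasing near $p$). A stabilising X-point $p=Y_i\bowtie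 Y_j$ is proper if $\{Y_i,Y_j\}$ is the only pair of functions in $\Xi_{\tau(p)-1}$ which intersect transversally at $(p,Y_i(p))$ and both have multiplicity $1$ in $\Xi_{\tau(p)-1}$. A stabilising monotonic X-point $p=Y_i\bowtie Y_j$ in the bundle $\Xi_{\tau(p)-1}$ is active if $$\mathcal{Y}_p:=\{Y\in\Xi_{\tau(p)-1}:\ \Xi_{\tau(p)-1}(p)\cap(Y_i(p),Y(p))=\varnothing,\ m(p)\in[Y_i(p),Y(p))\}\neq\varnothing,$$ where $\Xi(p)$ is the multiset of values at $p$. Normal form orbit of order $t$ ($t\geqslant5$ odd): set $\gamma_{t-1}:=[0,1]$, $\mathcal{M}_{t-2}:=0$, $\mathcal{M}_{t-1}:=\frac12$, and for every $n\geqslant t$ let $y_n=n\mathcal{M}_{n-1}-(n-1)\mathcal{M}_{n-2}$, $\gamma_n=\gamma_{n-1}\uplus[y_n]$ (multiset union), $\mathcal{M}_n:=\mathcal{M}(\gamma_n)$ the median of $\gamma_n$ (these $\mathcal{M}_n$ are numbers, not the functions above). *)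

(* Defs.v *)
From HB Require Import structures.
From mathcomp Require Import all_boot all_order all_algebra.
From mathcomp Require Import all_classical all_reals all_analysis.
Import Order.TTheory GRing.Theory Num.Theory numFieldNormedType.Exports.

Set Implicit Arguments.
Unset Strict Implicit.
Unset Printing Implicit Defensive.

Local Open Scope classical_set_scope.
Local Open Scope ring_scope.

(* Finite multisets are represented by sequences, the multiplicity of an
   element being given by count_mem; multisets of functions use the classical
   equality test on R -> R. *)

Section MeanMedian.
Variable R : realType.

(* For odd size both indices are that of the middle element of the sorted
   sequence; for even size they are those of the two central elements. *)
Definition median (s : seq R) : R :=
  let s' := sort <=%R s in
  (s'`_((size s).-1./2) + s'`_((size s)./2)) / 2.

Definition mean (s : seq R) : R := (\sum_(y <- s) y) / (size s)%:R.

Definition values (s : seq (R -> R)) (x : R) : seq R := [seq f x | f <- s].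

Definition mm_next (s : seq (R -> R)) : R -> R := fun x =>
  (size s).+1%:R * median (values s x) - (size s)%:R * mean (values s x).

Definition Xi_init : seq (R -> R) := [:: fun=> 0; id; fun=> 1].

(* Xi n = [Y 1; ...; Y n]; the truncation only acts for n < 3. *)
Definition Xi (n : nat) : seq (R -> R) :=
  take n (iter (n - 3) (fun s => rcons s (mm_next s)) Xi_init).

(* Indices start at 1, as in Xi; Y 0 is a junk value. *)
Definition Y (n : nat) : R -> R := nth (fun=> 0) (Xi n) n.-1.

Definition M (n : nat) (x : R) : R := median (values (Xi n) x).

Definition constant_from (x : R) (n : nat) : Prop :=
  (0 < n)%N /\ forall k, Y (n + k) x = Y n x.

(* The transit time; None stands for infinity. *)
Definition tau (x : R) : option nat :=
  if pselect (exists n, `[< constant_from x n >]) is left h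
  then Some (ex_minn h) else None.

Definition m (x : R) : R := lim (Y n x @[n --> \oo]).

(* p = f |><| g *)
Definition xpoint (f g : R -> R) (p : rat) : Prop :=
  exists2 e : R, 0 < e &
    [set` `]ratr p - e, ratr p + e[] `&`
      [set x | range (@ratr R) x /\ f x = g x] = [set ratr p].

(* Two functions intersect transversally at (p, v) when they meet there and
   p is an isolated point of coincidence. *)
Definition meet_transversally (f g : R -> R) (p : rat) (v : R) : Prop :=
  [/\ f (ratr p) = v, g (ratr p) = v & xpoint f g p].

(* Only non-decreasing median sequences are considered; M n is meaningful
   from n = 3 on. *)
Definition monotonic (p : rat) : Prop :=
  \forall x \near (ratr p : R), forall n, (3 <= n)%N -> M n x <= M n.+1 x.

Definition stabilising (p : rat) : Prop := tau (ratr p) <> None.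

(* Xi_{tau(p) - 1}; only used at stabilising p. *)
Definition bundle_at (p : rat) : seq (R -> R) :=
  if tau (ratr p) is Some t then Xi t.-1 else [::].

Definition proper_xpoint (i j : nat) (p : rat) : Prop :=
  [/\ xpoint (Y i) (Y j) p, stabilising p,
      meet_transversally (Y i) (Y j) p (Y i (ratr p)),
      (forall f g : R -> R, f \in bundle_at p -> g \in bundle_at p ->
         meet_transversally f g p (Y i (ratr p)) ->
         (f = Y i /\ g = Y j) \/ (f = Y j /\ g = Y i)) &
      count_mem (Y i) (bundle_at p) = 1%N /\
      count_mem (Y j) (bundle_at p) = 1%N].

Definition active_set (i : nat) (p : rat) : set (R -> R) :=
  [set f | [/\ f \in bundle_at p,
    [set y | y \in values (bundle_at p) (ratr p)] `&`
      [set` `]Y i (ratr p), f (ratr p)[] = set0 &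
    m (ratr p) \in `[Y i (ratr p), f (ratr p)[ ]].

Definition active_xpoint (i j : nat) (p : rat) : Prop :=
  [/\ xpoint (Y i) (Y j) p, stabilising p, monotonic p,
      Y i \in bundle_at p /\ Y j \in bundle_at p &
      active_set i p !=set0].

(* Normal form orbit of order t. After k steps the state is the triple
   (gamma_n, M_{n-1}, M_n) with n = t - 1 + k. *)
Definition nf_value (n : nat) (st : seq R * R * R) : R :=
  let: (_, a, b) := st in n%:R * b - n.-1%:R * a.

Definition nf_step (n : nat) (st : seq R * R * R) : seq R * R * R :=
  let: (g, _, b) := st in
  let g' := rcons g (nf_value n st) in (g', b, median g').

Fixpoint nf_state (t k : nat) : seq R * R * R :=
  if k is k'.+1 then nf_step (t + k') (nf_state t k')
  else ([:: 0; 1], 0, 2^-1).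

(* The term y_n, for n >= t. *)
Definition nf_orbit (t n : nat) : R := nf_value n (nf_state t (n - t)).

Definition side (right : bool) (a : R) : set_system R :=
  if right then a^'+ else a^'-.

Definition stabilises (t : nat) (u : nat -> R) : Prop :=
  exists2 N, (t <= N)%N & forall n, (N <= n)%N -> u n = u N.

(* Eventual constancy as a sequence of functions on a common neighbourhood. *)
Definition stabilises_near (F : set_system R) (t : nat) (U : nat -> R -> R) :
    Prop :=
  exists2 N, (t <= N)%N &
    \forall x \near F, forall n, (N <= n)%N -> U n x = U N x.

End MeanMedian.

Arguments Xi {R} n.
Arguments Y {R} n x.
Arguments M {R} n x.
Arguments tau {R} x.
Arguments nf_orbit {R} t n.
Arguments proper_xpoint R i j p : clear implicits.
Arguments active_xpoint R i j p : clear implicits.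

(* Main.v *)
Require Import Defs.
From HB Require Import structures.
From mathcomp Require Import all_boot all_order all_algebra.
From mathcomp Require Import all_classical all_reals all_analysis.
From mathcomp Require Import lra ring zify.
Import Order.TTheory GRing.Theory Num.Theory numFieldNormedType.Exports.
Local Open Scope classical_set_scope.
Local Open Scope ring_scope.
Set Implicit Arguments.
Unset Strict Implicit.
Unset Printing Implicit Defensive.

(** Write [X] for the point [p], [t = T.+2] for its transit time and [v] for
    the limit of the orbit at [X]. For [n >= 3] the mean of the first [n.+1]
    values is the median of the first [n], so the orbit is constant after a
    stage at which mean and median agree ([mean_median_fixed]), and no stage
    from 3 to [T] is of this kind. Hence at [X] the medians increase strictly
    up to stage [T], where they reach [v], and every new value up to stage
    [T.+1] lies strictly above the current median.

    Following the two middle order statistics under these strict inequalities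
    shows that they are attained by single functions before stage [T.-1]
    ([nlt_median_odd], [nle_median_odd], [ostatS_median_even]), that [T] is
    odd ([T_odd]), and that the functions numbered [T] (when [T > 3]) and
    [T.+1] lie above [v] at [X]. An order statistic attained by a single
    function at [X] is attained by the same function near [X], so the earlier
    medians, and with them all functions through [(X, v)], are affine near
    [X] ([affine_near_Y], [le_v_index]). This is where properness acts: of
    several affine germs through one point, any two agree or cross
    transversally, so [Y i] and [Y j] are the only functions of the bundle
    through [(X, v)] ([proper_partition]). Activity is used to see that the
    crossing takes place at height [v] ([active_xpoint_value]).

    In the bundle of [T.+1] functions exactly [T./2] functions lie below [v]
    at [X], hence as many lie above. On the side where [Y i < Y j], the
    median of the first [T] functions is therefore [Y i], and the next one is
    the midpoint of [Y i] and [Y j]. As long as the later values stay between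
    the lower and upper functions, these two groups cancel in every median
    ([median_sandwich]), and the orbit is the image of the normal form under
    the affine map sending 0 to [Y i] and 1 to [Y j] ([nf_invariant]). The
    later values do stay there close to [X], because [Y j - Y i] tends to 0,
    on a neighbourhood depending only on a bound for the normal form orbit
    ([nf_orbit_near]); an eventually constant orbit is bounded, so for it a
    common neighbourhood exists. *)

(** * Order statistics and medians *)

Section OrderStatistics.
Variable R : realType.
Implicit Types (s : seq R) (w y : R) (q : nat).

Definition ostat s q : R := (sort <=%R s)`_q.
Definition nlt w s : nat := count (fun y => y < w) s.
Definition nle w s : nat := count (fun y => y <= w) s.

Lemma nlt_rcons w s y : nlt w (rcons s y) = (nlt w s + (y < w)%R)%N.
Proof. by rewrite /nlt -cats1 count_cat /= addn0. Qed.

Lemma nle_rcons w s y : nle w (rcons s y) = (nle w s + (y <= w)%R)%N.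
Proof. by rewrite /nle -cats1 count_cat /= addn0. Qed.

Lemma nle_le_nlt w w' s : w < w' -> (nle w s <= nlt w' s)%N.
Proof. by move=> ww'; apply: sub_count => y /= /le_lt_trans; apply. Qed.

(** Comparisons of an order statistic with a threshold become comparisons of
    natural numbers. Every later argument about medians runs through this
    translation, since a count, unlike a sorted list, is easy to update when
    an element is added. *)
Lemma ostat_leE s q w : (q < size s)%N -> (ostat s q <= w) = (q < nle w s)%N.
Proof.
move=> qs; have ss := sort_le_sorted s.
have cE : nle w s = count (<= w) (sort <=%R s) by rewrite /nle count_sort.
rewrite cE; case: ltnP => c; first by rewrite /ostat nth_count_le.
apply/negbTE; rewrite -ltNge; apply: nth_count_gt => //.
by rewrite size_sort c.
Qed.

Lemma ostat_ltE s q w : (q < size s)%N -> (ostat s q < w) = (q < nlt w s)%N.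
Proof.
move=> qs; have ss := sort_le_sorted s.
have cE : nlt w s = count (< w) (sort <=%R s) by rewrite /nlt count_sort.
rewrite cE; case: ltnP => c; first by rewrite /ostat nth_count_lt.
apply/negbTE; rewrite -leNgt; apply: nth_count_ge => //.
by rewrite size_sort c.
Qed.

Lemma ostat_eq s q w : (nlt w s <= q < nle w s)%N -> ostat s q = w.
Proof.
case/andP=> c1 c2.
have qs : (q < size s)%N by apply: leq_trans c2 (count_size _ _).
by apply/eqP; rewrite eq_le ostat_leE // c2 /= leNgt ostat_ltE // -leqNgt.
Qed.

Lemma ostat_count s q w : (q < size s)%N -> ostat s q = w ->
  (nlt w s <= q < nle w s)%N.
Proof.
move=> qs e; rewrite -ostat_leE // e lexx andbT leqNgt -ostat_ltE //.
by rewrite e ltxx.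
Qed.

Lemma ostat_rcons s q y : (q < size s)%N -> ostat s q <= y ->
  ostat (rcons s y) q = ostat s q.
Proof.
move=> qs qy; apply: ostat_eq.
have /andP[c1 c2] := ostat_count qs (erefl _).
by rewrite nlt_rcons nle_rcons ltNge qy addn0 c1 (leq_trans c2) ?leq_addr.
Qed.

Lemma ostatS s q : (q.+1 < size s)%N -> ostat s q <= ostat s q.+1.
Proof.
move=> qs; have /andP[_ c] := ostat_count qs (erefl _).
by rewrite ostat_leE; lia.
Qed.

Lemma median_odd s q : size s = q.*2.+1 -> median s = ostat s q.
Proof.
move=> e; rewrite /median e; have -> : (q.*2.+1.-1./2 = q)%N by lia.
have -> : (q.*2.+1./2 = q)%N by lia.
by rewrite -/(ostat s q); lra.
Qed.

Lemma median_even s q : size s = q.+1.*2 ->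
  median s = (ostat s q + ostat s q.+1) / 2.
Proof.
move=> e; rewrite /median e; have -> : (q.+1.*2.-1./2 = q)%N by lia.
by have -> : (q.+1.*2./2 = q.+1)%N by lia.
Qed.

Lemma median_eq s w : (nlt w s <= (size s).-1./2)%N ->
  ((size s)./2 < nle w s)%N -> median s = w.
Proof.
move=> c1 c2; rewrite /median -/(ostat _ _) -/(ostat _ _).
by rewrite !(@ostat_eq _ _ w); [lra|lia..].
Qed.

Lemma median_rcons_median s : (0 < size s)%N ->
  median (rcons s (median s)) = median s.
Proof.
move=> s0; move e : (median s) => w.
have [[q eq]|[q eq]] :
    (exists q, size s = q.*2.+1) \/ (exists q, size s = q.+1.*2).
- case: (boolP (odd (size s))) => o; [left; exists (size s)./2; lia|].
  by right; exists (size s)./2.-1; lia.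
- rewrite (median_odd eq) in e.
  have /andP[c1 c2] := ostat_count (s := s) (q := q) ltac:(lia) e.
  apply: median_eq; rewrite ?nlt_rcons ?nle_rcons size_rcons ?ltxx ?lexx; lia.
rewrite (median_even eq) in e.
have z : ostat s q <= ostat s q.+1 by apply: ostatS; lia.
have z1 : ostat s q <= w by lra.
have z2 : ~~ (ostat s q.+1 < w) by rewrite -leNgt; lra.
rewrite ostat_leE ?ostat_ltE in z1 z2; [|lia..].
by apply: median_eq; rewrite ?nlt_rcons ?nle_rcons size_rcons ?ltxx ?lexx; lia.
Qed.

Lemma median_perm s s' : perm_eq s s' -> median s = median s'.
Proof.
by move=> e; rewrite /median (perm_size e) (perm_sort_leP _ _ e).
Qed.

Lemma median_affine (a d : R) s : 0 < d -> (0 < size s)%N ->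
  median [seq a + d * y | y <- s] = a + d * median s.
Proof.
move=> d0 s0; rewrite /median size_map.
rewrite -(@map_sort _ _ (fun y => a + d * y) <=%R <=%R); last first.
  by move=> x y; rewrite lerD2l ler_pM2l.
have i1 : ((size s).-1./2 < size s)%N by lia.
have i2 : ((size s)./2 < size s)%N by lia.
by rewrite !(nth_map 0) ?size_sort //; field.
Qed.

(** Equally many elements below and above a block cancel out in the median:
    this is what makes the dynamics near an active point depend on the
    crossing pair alone. *)
Lemma median_sandwich (L C U : seq R) :
  size L = size U -> (0 < size C)%N ->
  (forall l c, l \in L -> c \in C -> l <= c) ->
  (forall c u, c \in C -> u \in U -> c <= u) ->
  median (L ++ C ++ U) = median C.
Proof.
move=> LU C0 LC CU; rewrite /median.
have -> : sort <=%R (L ++ C ++ U) =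
    sort <=%R L ++ sort <=%R C ++ sort <=%R U.
  apply: le_sorted_eq; first exact: sort_le_sorted.
    rewrite !sorted_pairwise ?pairwise_cat; [|exact: le_trans..].
    rewrite -!sorted_pairwise; [|exact: le_trans..].
    rewrite !sort_le_sorted allrel_catr !andbT.
    apply/andP; split; [apply/andP; split|].
    - by apply/allrelP => l c; rewrite !mem_sort; exact: LC.
    - apply/allrelP => l u; rewrite !mem_sort => lL uU.
      case: C C0 LC CU => // c C _ LC CU.
      by apply: (@le_trans _ _ c); [apply: LC|apply: CU]; rewrite ?mem_head.
    - by apply/allrelP => c u; rewrite !mem_sort; exact: CU.
  by rewrite perm_sort perm_sym !perm_cat // perm_sort.
have mid k : (k < size C)%N ->
    (sort <=%R L ++ sort <=%R C ++ sort <=%R U)`_(size L + k) =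
    (sort <=%R C)`_k.
  move=> kC; rewrite nth_cat size_sort ltnNge leq_addr addKn.
  by rewrite nth_cat size_sort kC.
rewrite !size_cat -LU -!mid; [|lia..].
by congr ((nth _ _ _ + nth _ _ _) / _); lia.
Qed.

End OrderStatistics.

(** * The mean-median orbit at a point *)

Section Orbit.
Variable R : realType.
Implicit Types (x w : R) (n : nat).

Lemma size_iter_Xi n :
  size (iter n (fun s => rcons s (mm_next s)) (@Xi_init R)) = n.+3.
Proof. by elim: n => [//|n IHn]; rewrite iterS size_rcons IHn. Qed.

Lemma XiS n : (3 <= n)%N -> @Xi R n.+1 = rcons (Xi n) (mm_next (Xi n)).
Proof.
move=> n3; rewrite /Xi subSn // iterS.
by rewrite !take_oversize ?size_rcons ?size_iter_Xi //; lia.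
Qed.

Lemma size_Xi n : size (@Xi R n) = n.
Proof.
case: (leqP 3 n) => n3; first by rewrite /Xi size_takel // size_iter_Xi; lia.
by move: n n3 => [|[|[|]]].
Qed.

Lemma Y_mm_next n : (3 <= n)%N -> @Y R n.+1 = mm_next (Xi n).
Proof. by move=> n3; rewrite /Y XiS // nth_rcons size_Xi ltnn eqxx. Qed.

Lemma XiE n : @Xi R n = [seq Y k | k <- iota 1 n].
Proof.
case: (leqP 3 n) => [|n3]; last by move: n n3 => [|[|[|]]].
elim: n => // n IHn; rewrite leq_eqVlt => /orP[/eqP <- //|n3].
rewrite XiS // IHn // -[n.+1]addn1 iotaD map_cat /= cats1 add1n.
by rewrite Y_mm_next // -IHn.
Qed.

Lemma XiS_rcons n : @Xi R n.+1 = rcons (Xi n) (Y n.+1).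
Proof. by rewrite !XiE -[n.+1]addn1 iotaD map_cat /= cats1 add1n addn1. Qed.

Lemma values_rcons n x :
  values (Xi n.+1) x = rcons (values (Xi n) x) (Y n.+1 x).
Proof. by rewrite XiS_rcons /values map_rcons. Qed.

Lemma size_values n x : size (values (Xi n) x) = n.
Proof. by rewrite size_map size_Xi. Qed.

Lemma Y_next n x : (3 <= n)%N ->
  Y n.+1 x = n.+1%:R * M n x - n%:R * mean (values (Xi n) x).
Proof. by move=> n3; rewrite Y_mm_next // /mm_next size_Xi. Qed.

Lemma meanM n x : (0 < n)%N ->
  n%:R * mean (values (Xi n) x) = \sum_(y <- values (Xi n) x) y.
Proof.
by move=> n0; rewrite /mean size_values mulrC mulfVK // pnatr_eq0 -lt0n.
Qed.

(** The new function is chosen precisely so that the new mean is the old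
    median. *)
Lemma mean_next n x : (3 <= n)%N -> mean (values (Xi n.+1) x) = M n x.
Proof.
move=> n3; have n0 : n.+1%:R != 0 :> R by rewrite pnatr_eq0.
apply: (mulfI n0); rewrite meanM // values_rcons -cats1 big_cat big_seq1 /=.
by rewrite Y_next // -meanM ?(leq_trans _ n3) //; ring.
Qed.

Lemma Y_next_median n x : (3 <= n)%N ->
  Y n.+2 x = n.+2%:R * M n.+1 x - n.+1%:R * M n x.
Proof. by move=> n3; rewrite Y_next 1?ltnW // mean_next. Qed.

(** Once mean and median coincide, the next value is that common number, and
    adding it changes neither: the orbit is constant from there on. *)
Lemma mean_median_fixed n x : (3 <= n)%N -> mean (values (Xi n) x) = M n x ->
  constant_from x n.+1.
Proof.
move=> n3 e; set w := M n x.
have inv k : mean (values (Xi (n + k)) x) = w /\ M (n + k) x = w.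
  elim: k => [|k [IHe IHM]]; first by rewrite addn0.
  have nk3 : (3 <= n + k)%N by lia.
  rewrite addnS mean_next // IHM; split=> //.
  have -> : M (n + k).+1 x = median (rcons (values (Xi (n + k)) x) w).
    rewrite /M values_rcons Y_next // IHe IHM.
    by congr (median (rcons _ _)); ring.
  by rewrite -{1}IHM median_rcons_median ?size_values //; lia.
have Yw k : Y (n + k).+1 x = w.
  have [e1 e2] := inv k; rewrite Y_next ?e1 ?e2; [ring|lia].
by split=> // k; rewrite addSn Yw -[n]addn0 Yw.
Qed.

Lemma tauP x t : tau x = Some t ->
  constant_from x t /\ (forall n, constant_from x n -> (t <= n)%N).
Proof.
rewrite /tau; case: pselect => // h [<-]; case: ex_minnP => k /asboolP ck kmin.
by split=> // n cn; apply: kmin; apply/asboolP.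
Qed.

Lemma m_constant_from x t : constant_from x t -> m x = Y t x.
Proof.
case=> _ c; rewrite /m; apply/cvg_lim => //; apply: cvg_near_cst.
by exists t => // n /= tn; rewrite -(subnKC tn) c.
Qed.

Lemma count_tail x t k : constant_from x t ->
  (nlt (Y t x) (values (Xi (t.-1 + k)) x) <= t.-1)%N /\
  (k <= nle (Y t x) (values (Xi (t.-1 + k)) x))%N.
Proof.
move=> [t0 c]; elim: k => [|k [IH1 IH2]].
  rewrite addn0; split=> //.
  by rewrite (leq_trans (count_size _ _)) // size_values.
have e : Y (t.-1 + k).+1 x = Y t x by rewrite -addSn prednK.
by rewrite addnS values_rcons nlt_rcons nle_rcons e ltxx lexx addn0 addn1.
Qed.

Lemma sum_tail x t k : constant_from x t ->
  \sum_(y <- values (Xi (t.-1 + k)) x) y =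
  \sum_(y <- values (Xi t.-1) x) y + k%:R * Y t x.
Proof.
move=> [t0 c]; elim: k => [|k IH]; first by rewrite addn0 mul0r addr0.
rewrite addnS values_rcons -cats1 big_cat big_seq1 /= IH -addSn prednK // c.
by rewrite mulrSr; ring.
Qed.

(** Far enough in the tail the repeated value is the majority, hence the
    median, hence the mean of the next stage. Removing copies of this value
    from a multiset with this mean does not change the mean, so the equality
    goes back to the first stage of the tail. *)
Lemma mean_tail x t k : (1 < t)%N -> constant_from x t ->
  mean (values (Xi (t.-1 + k)) x) = Y t x.
Proof.
move=> t1 c; set v := Y t x.
have Mv : M (t.-1 + t.+1) x = v.
  have := count_tail t.+1 c; rewrite -/v => -[c1 c2].
  by rewrite /M; apply: median_eq; rewrite size_values -/v; lia.
have Sv : \sum_(y <- values (Xi t.-1) x) y = t.-1%:R * v.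
  have := mean_next x (n := t.-1 + t.+1) ltac:(lia).
  rewrite Mv -addnS => e; have := sum_tail t.+2 c.
  rewrite -meanM ?e; last lia.
  by rewrite natrD -/v mulrDl => /addIr.
have k0 : (t.-1 + k)%:R != 0 :> R by rewrite pnatr_eq0; lia.
apply: (mulfI k0); rewrite meanM; last lia.
by rewrite sum_tail // Sv natrD mulrDl.
Qed.

Lemma median_tail x n k : (3 <= n)%N -> constant_from x n.+2 ->
  M (n + k) x = Y n.+2 x.
Proof.
move=> n3 c; have := mean_tail k (t := n.+2) isT c.
by rewrite addSn mean_next //; lia.
Qed.

Lemma median3 x : 0 < x < 1 -> M 3 x = x.
Proof.
case/andP=> x0 x1; rewrite /M.
apply: median_eq; rewrite size_values /nlt /nle /=.
  by rewrite x0 ltxx ltNge (ltW x1).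
by rewrite (ltW x0) lexx leNgt x1.
Qed.

End Orbit.

(** * The orbit before its transit time *)

Section AtThePoint.
(* [T] is the transit time minus 2, so that the last medians before
   stabilisation are [M T] and [M T.+1]. *)
Variables (R : realType) (x : R) (T : nat).
Hypothesis T3 : (3 <= T)%N.
Hypothesis tauE : tau x = Some T.+2.
Hypothesis x_bnd : 1 / 2 <= x < 1.
Hypothesis M_mono : forall n, (3 <= n)%N -> M n x <= M n.+1 x.

Let s n := values (Xi n) x.
Let size_s n : size (s n) = n. Proof. exact: size_values. Qed.
Let sS n : s n.+1 = rcons (s n) (Y n.+1 x). Proof. exact: values_rcons. Qed.
Let x01 : 0 < x < 1.
Proof. by case/andP: x_bnd => *; apply/andP; split; lra. Qed.

(** The inequality in the wide sense is monotonicity of the medians, the mean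
    of a stage being the previous median, and at stage 3 it says [(1 + x) / 3
    <= x], whence the bound [1 / 2 <= x]. Equality would stabilise the orbit
    before its transit time. *)
Lemma mean_lt_median n : (3 <= n <= T)%N -> mean (s n) < M n x.
Proof.
case/andP=> n3 nT; have [_ tmin] := tauP tauE.
rewrite lt_neqAle; apply/andP; split.
  by apply/eqP => /(mean_median_fixed n3) /tmin; lia.
case: n n3 nT => [//|n] n3 nT.
move: (n3); rewrite leq_eqVlt => /orP[/eqP n2|n3'].
  rewrite -n2 median3; last exact: x01.
  by rewrite /mean /s /= !big_cons big_nil; case/andP: x_bnd => *; lra.
by rewrite mean_next // M_mono.
Qed.

Lemma next_gt_median n : (3 <= n <= T)%N -> M n x < Y n.+1 x.
Proof.
move=> nT; have lt := mean_lt_median nT; have n3 : (3 <= n)%N by case/andP: nT.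
rewrite Y_next // -subr_gt0.
have -> : n.+1%:R * M n x - n%:R * mean (values (Xi n) x) - M n x =
          n%:R * (M n x - mean (s n)) by rewrite -natr1; rewrite /s; ring.
by rewrite mulr_gt0 ?ltr0n ?subr_gt0 //; lia.
Qed.

Lemma median_lt_next n : (3 <= n < T)%N -> M n x < M n.+1 x.
Proof. by case/andP=> n3 nT; rewrite -mean_next // mean_lt_median //; lia. Qed.

Lemma ostat_median_odd q : ostat (s q.*2.+1) q = M q.*2.+1 x.
Proof. by rewrite /M (median_odd (q := q)) ?size_s. Qed.

Lemma median_even_s q :
  M q.+1.*2 x = (ostat (s q.+1.*2) q + ostat (s q.+1.*2) q.+1) / 2.
Proof. by rewrite /M (median_even (q := q)) ?size_s. Qed.

(** At odd stages the median is not tied with an element of lower rank: after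
    stage 3, where the values are distinct, that element survives from the
    previous stage, where it is at most the strictly smaller previous
    median. *)
Lemma nlt_median_odd q :
  (3 <= q.*2.+1 <= T)%N -> nlt (M q.*2.+1 x) (s q.*2.+1) = q.
Proof.
move=> qT; apply/eqP; rewrite eqn_leq.
have qs : (q < size (s q.*2.+1))%N by rewrite size_s; lia.
have /andP[-> _] := ostat_count qs (ostat_median_odd q).
case: q qT qs => // -[|q] qT _.
  rewrite median3; last exact: x01.
  by have /andP[x0 x1] := x01; rewrite /nlt /= x0 ltxx ltNge (ltW x1).
have qn : (q.+1 < size (s q.+2.*2))%N by rewrite size_s; lia.
have Me := median_even_s q.+1.
have z : ostat (s q.+2.*2) q.+1 <= ostat (s q.+2.*2) q.+2.
  by apply: ostatS; rewrite size_s; lia.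
have := median_lt_next (n := q.+2.*2) ltac:(lia).
have := next_gt_median (n := q.+2.*2) ltac:(lia).
move=> Yg Mg; rewrite sS nlt_rcons.
have : ostat (s q.+2.*2) q.+1 < M q.+2.*2.+1 x by lra.
by rewrite ostat_ltE //; lia.
Qed.

Lemma ostat_median_even q : (3 <= q.*2.+1 <= T)%N ->
  ostat (s q.+1.*2) q = M q.*2.+1 x.
Proof.
move=> qT.
rewrite doubleS sS ostat_rcons ?ostat_median_odd ?size_s //; first by lia.
by rewrite ltW // next_gt_median.
Qed.

(** A tie with an element of higher rank would leave the next median
    unchanged, although the medians increase strictly up to stage [T]. *)
Lemma nle_median_odd q :
  (3 <= q.*2.+1 < T)%N -> nle (M q.*2.+1 x) (s q.*2.+1) = q.+1.
Proof.
move=> qT; apply/eqP; rewrite eqn_leq.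
have qs : (q < size (s q.*2.+1))%N by rewrite size_s; lia.
have /andP[_ ->] := ostat_count qs (ostat_median_odd q).
rewrite andbT; have Mg := median_lt_next qT.
have Yg := next_gt_median (n := q.*2.+1) ltac:(lia).
have := median_even_s q; rewrite ostat_median_even; last lia.
rewrite doubleS => Me.
have : ~~ (ostat (s q.*2.+2) q.+1 <= M q.*2.+1 x) by rewrite -ltNge; lra.
rewrite ostat_leE ?size_s; last lia.
by rewrite -leqNgt sS nle_rcons; lia.
Qed.

(** At an even stage with middle values [a < z] and median [b = (a + z) / 2],
    the previous median is [a], so that the next value is far above [b]: it
    exceeds even [z], which therefore is the next median. *)
Lemma ostatS_median_even q : (3 <= q.*2.+1)%N -> (q.+1.*2 < T)%N ->
  ostat (s q.+1.*2) q.+1 = M q.+1.*2.+1 x /\ M q.+1.*2.+1 x < Y q.+1.*2.+1 x.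
Proof.
move=> q3 qT; have Me := median_even_s q.
rewrite ostat_median_even in Me; last lia.
have Mg := median_lt_next (n := q.*2.+1) ltac:(lia).
have Yn := Y_next_median x (n := q.*2.+1) q3.
have Yg : ostat (s q.+1.*2) q.+1 < Y q.+1.*2.+1 x.
  move: Yn Mg Me; rewrite doubleS.
  set a := M q.*2.+1 x; set b := M q.*2.+2 x; set z := ostat _ _.
  move=> -> ab bE; rewrite -subr_gt0.
  have -> : z = 2 * b - a by lra.
  have -> : q.*2.+3%:R * b - q.*2.+2%:R * a - (2 * b - a) =
            q.*2.+1%:R * (b - a).
    by rewrite -[q.*2.+3]addn2 -[q.*2.+2]addn1 !natrD; ring.
  by rewrite mulr_gt0 ?ltr0n ?subr_gt0.
have e : ostat (s q.+1.*2) q.+1 = M q.+1.*2.+1 x.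
  by rewrite -ostat_median_odd sS ostat_rcons ?size_s ?(ltW Yg) //; lia.
by rewrite -e.
Qed.

Let v := Y T.+2 x.

Lemma median_T : M T x = v /\ M T.+1 x = v.
Proof.
have [c _] := tauP tauE.
by rewrite -{1}[T]addn0 -[T.+1]addn1 !(median_tail _ T3 c).
Qed.

(** If [T] were even, [M T = v] would be the mean of two distinct middle
    values, as the lower one is the smaller [M T.-1]. The upper one and the
    next value would both exceed [v], and so would [M T.+1]. *)
Lemma T_odd : odd T.
Proof.
apply/negPn/negP => Te; have [MT MT1] := median_T.
have [q qE] : exists q, T = q.+1.*2 by exists T./2.-1; lia.
have q3 : (3 <= q.*2.+1)%N by lia.
have Mg := median_lt_next (n := q.*2.+1) ltac:(lia).
have Yg := next_gt_median (n := T) ltac:(lia).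
have := median_even_s q; rewrite ostat_median_even -?qE; last lia.
rewrite MT => Me; rewrite -doubleS -qE MT in Mg.
have : v < ostat (s T) q.+1 by lra.
rewrite ltNge ostat_leE ?size_s; last lia.
have := ostat_median_odd q.+1; rewrite -qE MT1 => /ostat_count.
rewrite size_s => /(_ ltac:(lia)) /andP[_]; rewrite sS nle_rcons.
rewrite MT in Yg; rewrite [Y _ _ <= v]leNgt Yg; lia.
Qed.

Lemma next_T_gt : v < Y T.+1 x.
Proof. by have [<- _] := median_T; apply: next_gt_median; lia. Qed.

Lemma nlt_T : nlt v (s T.+1) = T./2.
Proof.
have Yg := next_T_gt; rewrite sS nlt_rcons [_ < v]ltNge (ltW Yg) addn0.
have [<- _] := median_T; have TE : T = T./2.*2.+1 by have := T_odd; lia.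
by rewrite {1 2}TE nlt_median_odd //; lia.
Qed.

(** The functions numbered [T.+1] and, when [T > 3], [T] lie above [v] at
    [x]; these are the ones whose germs at [x] may have a kink. *)
Lemma le_v_index k :
  (0 < k <= T.+1)%N -> Y k x <= v -> (k <= maxn 3 T.-1)%N.
Proof.
move=> kT kv; have Yg := next_T_gt; case: (leqP T 3) => T3'.
  have TE : T = 3 by lia.
  have [kE|] : k = T.+1 \/ (k <= T)%N by lia.
    by rewrite kE leNgt Yg in kv.
  by lia.
have [q qE] : exists q, T = q.+1.*2.+1 by exists T./2.-1; have := T_odd; lia.
have [_] := ostatS_median_even (q := q) ltac:(lia) ltac:(lia).
rewrite -qE; have [-> _] := median_T => Yg'.
have [kE|[kE|]] : k = T.+1 \/ k = T \/ (k < T)%N by lia.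
- by rewrite kE leNgt Yg in kv.
- by rewrite kE leNgt Yg' in kv.
lia.
Qed.

End AtThePoint.

(** * Continuity and affine germs *)

Lemma sub_in_count (T : eqType) (a b : pred T) (s : seq T) :
  {in s, forall y, a y -> b y} -> (count a s <= count b s)%N.
Proof.
move=> ab; rewrite -!size_filter -(@eq_in_filter _ (predI b a) a) => [|y ys /=].
  by rewrite !size_filter; apply: sub_count => y /andP[].
by case: (boolP (a y)) => [/(ab y ys) ->|]; rewrite ?andbF.
Qed.

Section Germs.
Variable R : realType.
Implicit Types (p x w : R) (f g c : R -> R) (F : seq (R -> R)).

Lemma near_seq (G : set_system R) (FG : Filter G) F
    (P : (R -> R) -> R -> Prop) :
  (forall g, g \in F -> \forall x \near G, P g x) ->
  \forall x \near G, forall g, g \in F -> P g x.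
Proof.
elim: F => [|g F IHF] H; first by apply: nearW.
have H1 := H g (mem_head _ _).
have H2 := IHF (fun h hF => H h (mem_behead (s := g :: F) hF)).
apply: filterS2 H1 H2 => x Pg PF h; rewrite inE => /orP[/eqP -> //|].
exact: PF.
Qed.

Definition continuous_pt p f := {for p, continuous f}.

Lemma continuous_pt_cst p w : continuous_pt p (fun=> w).
Proof. exact: cvg_cst. Qed.
Arguments continuous_pt_cst : clear implicits.

Lemma lt_near p f g : continuous_pt p f -> continuous_pt p g -> f p < g p ->
  \forall x \near p, f x < g x.
Proof.
move=> cf cg fg; have cgf : {for p, continuous (g \- f)} by apply: continuousB.
have : \forall x \near p, 0 < (g \- f) x.
  by apply: cvgr_gt cgf _ _; rewrite /= subr_gt0.
by apply: filterS => x /=; rewrite subr_gt0.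
Qed.

(** Strict inequalities at [p] persist nearby; this is all the continuity
    that order statistics need. *)
Lemma count_near p c F : continuous_pt p c ->
  (forall g, g \in F -> continuous_pt p g) ->
  \forall x \near p,
    (nlt (c p) (values F p) <= nlt (c x) (values F x))%N /\
    (nle (c x) (values F x) <= nle (c p) (values F p))%N.
Proof.
move=> cc cF.
have H1 : \forall x \near p, forall g, g \in F -> g p < c p -> g x < c x.
  apply: (@near_seq (nbhs p) _ F (fun g x => g p < c p -> g x < c x)).
  move=> g /cF cg.
  case: (ltP (g p) (c p)) => [lt|_]; last exact: nearW.
  by apply: filterS (lt_near cg cc lt).
have H2 : \forall x \near p, forall g, g \in F -> c p < g p -> c x < g x.
  apply: (@near_seq (nbhs p) _ F (fun g x => c p < g p -> c x < g x)).
  move=> g /cF cg.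
  case: (ltP (c p) (g p)) => [lt|_]; last exact: nearW.
  by apply: filterS (lt_near cc cg lt).
apply: filterS2 H1 H2 => x h1 h2; rewrite /nlt /nle /values !count_map; split.
  by apply: sub_in_count => g gF /=; exact: h1.
apply: sub_in_count => g gF /=; rewrite !leNgt; apply: contra; exact: h2.
Qed.

Lemma ostat_continuous p F q : (q < size F)%N ->
  (forall g, g \in F -> continuous_pt p g) ->
  continuous_pt p (fun x => ostat (values F x) q).
Proof.
move=> qF cF; apply/cvgrPdist_le => e e0.
set w := ostat (values F p) q.
have sz x : size (values F x) = size F by rewrite size_map.
have /andP[c1 c2] : (nlt w (values F p) <= q < nle w (values F p))%N.
  by apply: ostat_count; rewrite ?sz.
have H1 := count_near (continuous_pt_cst p (w + e)) cF.
have H2 := count_near (continuous_pt_cst p (w - e)) cF.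
apply: filterS2 H1 H2 => x [h1 _] [_ h2].
have hw1 : (nle w (values F p) <= nlt (w + e) (values F p))%N.
  by apply: nle_le_nlt; rewrite ltrDl.
have hw2 : (nle (w - e) (values F p) <= nlt w (values F p))%N.
  by apply: nle_le_nlt; rewrite ltrBlDr ltrDl.
have u1 : ostat (values F x) q < w + e by rewrite ostat_ltE ?sz //; lia.
have u2 : ~~ (ostat (values F x) q <= w - e) by rewrite ostat_leE ?sz //; lia.
by rewrite -ltNge in u2; rewrite ler_norml; apply/andP; split; lra.
Qed.

Lemma median_continuous p F : (0 < size F)%N ->
  (forall g, g \in F -> continuous_pt p g) ->
  continuous_pt p (fun x => median (values F x)).
Proof.
move=> F0 cF.
have -> : (fun x => median (values F x)) =
    (fun x => (ostat (values F x) (size F).-1./2 +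
               ostat (values F x) (size F)./2) / 2).
  by apply/funext => x; rewrite /median size_map.
apply: cvgM; last exact: cvg_cst.
by apply: cvgD; apply: ostat_continuous => //; lia.
Qed.

Lemma Y_continuous p n : continuous_pt p (Y n).
Proof.
have cY0 : forall k, (k <= 3)%N -> continuous_pt p (@Y R k).
  by case=> [_|[_|[_|[_|//]]]]; (exact: (continuous_pt_cst p) || exact: cvg_id).
elim/ltn_ind: n => n IHn; case: (leqP n 3) => [/cY0 //|].
move: n IHn => [//|n] IHn n3.
have cX g : g \in Xi n -> continuous_pt p g.
  by rewrite XiE => /mapP[k]; rewrite mem_iota => kn ->; apply: IHn; lia.
have -> : @Y R n.+1 = (fun x => n.+1%:R * M n x - \sum_(g <- Xi n) g x).
  apply/funext => x; rewrite Y_next // meanM; last lia.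
  by rewrite /values big_map.
apply: cvgB.
  apply: cvgM; [exact: cvg_cst|apply: median_continuous => //].
  by rewrite size_Xi; lia.
elim: (Xi n) cX => [|g s IHs] cX.
  under eq_fun do rewrite big_nil.
  by rewrite big_nil; exact: cvg_cst.
under eq_fun do rewrite big_cons.
rewrite big_cons; apply: cvgD; first by apply: cX; rewrite mem_head.
by apply: IHs => h hs; apply: cX; rewrite inE hs orbT.
Qed.

Lemma Xi_continuous p n g : g \in Xi n -> continuous_pt p g.
Proof. by rewrite XiE => /mapP[k _ ->]; exact: Y_continuous. Qed.

(** When a single function attains the order statistic at [p], it also
    attains it nearby: by [count_near] its rank cannot change. *)
Lemma ostat_simple_germ p F q w : (forall g, g \in F -> continuous_pt p g) ->
  nlt w (values F p) = q -> nle w (values F p) = q.+1 ->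
  exists2 f, f \in F & \forall x \near p, ostat (values F x) q = f x.
Proof.
move=> cF lq leq.
have : w \in values F p.
  have := count_lt_le_mem w (values F p).
  by rewrite -/(nlt w (values F p)) -/(nle w (values F p)) lq leq ltnSn => <-.
case/mapP=> f fF fw; exists f => //.
apply: filterS (count_near (cF f fF) cF) => x; rewrite -fw lq leq => -[h1 h2].
apply: ostat_eq; have := count_lt_le_mem (f x) (values F x).
rewrite -/(nlt (f x) (values F x)) -/(nle (f x) (values F x)).
by rewrite (map_f (fun g => g x) fF) => h3; lia.
Qed.

Definition affine_near p f := exists a b, \forall x \near p, f x = a + b * x.

Lemma affine_near_id p : affine_near p id.
Proof. by exists 0, 1; apply: filterE => x; rewrite add0r mul1r. Qed.

Lemma affine_near_cst p w : affine_near p (fun=> w).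
Proof. by exists w, 0; apply: filterE => x; rewrite mul0r addr0. Qed.

Lemma affine_near_lin p f g k l : affine_near p f -> affine_near p g ->
  affine_near p (fun x => k * f x + l * g x).
Proof.
move=> [a [b H]] [a' [b' H']]; exists (k * a + l * a'), (k * b + l * b').
by apply: filterS2 H H' => x -> ->; ring.
Qed.

Lemma affine_near_eq p f g : (\forall x \near p, f x = g x) ->
  affine_near p g -> affine_near p f.
Proof.
by move=> H [a [b H']]; exists a, b; apply: filterS2 H H' => x -> ->.
Qed.

Lemma affine_near_sum p F : (forall g, g \in F -> affine_near p g) ->
  affine_near p (fun x => \sum_(g <- F) g x).
Proof.
elim: F => [|g F IHF] H.
  apply: affine_near_eq (affine_near_cst p 0).
  by apply: filterE => x; rewrite big_nil.
have H1 := H g (mem_head _ _).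
have H2 := IHF (fun h hF => H h (mem_behead (s := g :: F) hF)).
apply: affine_near_eq (affine_near_lin 1 1 H1 H2).
by apply: filterE => x; rewrite big_cons !mul1r.
Qed.

(** Kinks are created only where the median passes through a crossing. Before
    stage [T.-1] the middle order statistics at [p] are attained by single
    functions, so the medians near [p] are averages of functions of the
    bundle, and affine germs produce affine germs. *)
Lemma affine_near_Y p T : (3 <= T)%N -> tau p = Some T.+2 -> 1 / 2 <= p < 1 ->
  (forall n, (3 <= n)%N -> M n p <= M n.+1 p) ->
  forall k, (k <= maxn 3 T.-1)%N -> affine_near p (Y k).
Proof.
move=> T3 tauE pb mono; have To := T_odd T3 tauE pb mono.
elim/ltn_ind=> k IH kT; case: (leqP k 3) => k3.
  move: k k3 {IH kT} => [|[|[|[|//]]]] _; try exact: affine_near_cst.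
  exact: affine_near_id.
move: k IH kT k3 => [//|n] IH nT n3.
have aX F : F = Xi n -> forall g, g \in F -> affine_near p g.
  move=> -> g; rewrite XiE => /mapP[k]; rewrite mem_iota => kn ->.
  by apply: IH; lia.
have aS := affine_near_sum (aX _ erefl).
suff aM : affine_near p (M n).
  apply: affine_near_eq (affine_near_lin n.+1%:R (-1) aM aS).
  apply: filterE => x; rewrite Y_next // meanM; last lia.
  by rewrite /values big_map mulN1r.
have cX g : g \in Xi n -> continuous_pt p g by exact: Xi_continuous.
have simple q w :
    nlt w (values (Xi n) p) = q -> nle w (values (Xi n) p) = q.+1 ->
    affine_near p (fun x => ostat (values (Xi n) x) q).
  move=> h1 h2; have [f fX fE] := ostat_simple_germ cX h1 h2.
  exact: affine_near_eq fE (aX _ erefl _ fX).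
case: (boolP (odd n)) => no.
  have [q qE] : exists q, n = q.*2.+1 by exists n./2; lia.
  have MQ : M n = (fun x => ostat (values (Xi n) x) q).
    by apply/funext => x; rewrite /M (median_odd (q := q)) ?size_values.
  rewrite MQ; apply: (simple q (M n p)); rewrite qE.
    by apply: (nlt_median_odd T3 tauE pb mono); lia.
  by apply: (nle_median_odd T3 tauE pb mono); lia.
have [q qE] : exists q, n = q.+1.*2 by exists n./2.-1; lia.
have [q3 qT] : (3 <= q.*2.+1)%N /\ (q.+1.*2 < T)%N by split; lia.
have [e1 Yg] := ostatS_median_even T3 tauE pb mono q3 qT.
(* The upper middle value is the median of stage [n.+1]; it is simple already
   at stage [n], since the function added in between lies above it. *)
have l1 := nlt_median_odd T3 tauE pb mono (q := q) ltac:(lia).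
have l2 := nle_median_odd T3 tauE pb mono (q := q) ltac:(lia).
have l3 := nlt_median_odd T3 tauE pb mono (q := q.+1) ltac:(lia).
have l4 := nle_median_odd T3 tauE pb mono (q := q.+1) ltac:(lia).
have Yg' := next_gt_median T3 tauE pb mono (n := q.*2.+1) ltac:(lia).
have MQ : M n = (fun x => 2^-1 * ostat (values (Xi n) x) q +
                          2^-1 * ostat (values (Xi n) x) q.+1).
  apply/funext => x; rewrite /M (median_even (q := q)) ?size_values //.
  by rewrite mulrC mulrDr.
rewrite MQ; apply: affine_near_lin.
  apply: (simple q (M q.*2.+1 p)); rewrite qE doubleS values_rcons.
    by rewrite nlt_rcons l1 ltNge (ltW Yg') addn0.
  by rewrite nle_rcons l2 leNgt Yg' addn0.
apply: (simple q.+1 (M q.+1.*2.+1 p)); rewrite qE.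
  by move: l3; rewrite values_rcons nlt_rcons ltNge (ltW Yg) addn0.
by move: l4; rewrite values_rcons nle_rcons leNgt Yg addn0.
Qed.

End Germs.

(** * The bundle at a proper crossing *)

Section Crossing.
Variable R : realType.
Implicit Types (p : rat) (f g : R -> R) (F : seq (R -> R)).

Lemma affine_germs_meet p f g :
  affine_near (ratr p) f -> affine_near (ratr p) g ->
  f (ratr p) = g (ratr p) ->
  (\forall x \near (ratr p : R), f x = g x) \/ xpoint f g p.
Proof.
move=> [a [b Hf]] [a' [b' Hg]]; set X : R := ratr p => fg.
have fX := nbhs_singleton Hf; have gX := nbhs_singleton Hg.
case: (eqVneq b b') => bb.
  left; apply: filterS2 Hf Hg => x -> ->; rewrite -bb; congr (_ + _).
  by apply: (@addIr _ (b * X)); rewrite -fX fg gX bb.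
right; have /nbhs_ballP[e /= e0 He] :
    \forall x \near X, f x = a + b * x /\ g x = a' + b' * x.
  by apply: filterS2 Hf Hg.
exists e => //; apply/seteqP; split=> x /=; rewrite in_itv /=.
  case=> /andP[x1 x2] [_ fgx].
  have [f1 g1] : f x = a + b * x /\ g x = a' + b' * x.
    rewrite -/X in x1 x2; apply: He.
    by rewrite /ball /= ltr_norml; apply/andP; split; lra.
  have : (b - b') * (x - X) = 0.
    by rewrite mulrBl !mulrBr; lra.
  move/eqP; rewrite mulf_eq0 subr_eq0 (negbTE bb) /= subr_eq0 => /eqP -> //.
move=> ->; split; last by split=> //; exists p.
by rewrite -/X; apply/andP; split; lra.
Qed.

(** Rational points accumulate at [p], so coincidence near [p] contradicts
    isolation among them. *)
Lemma xpoint_not_near p f g : xpoint f g p ->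
  ~ (\forall x \near (ratr p : R), f x = g x).
Proof.
case=> e e0 /seteqP[sub _] /nbhs_ballP[d /= d0 Hd].
have m0 : 0 < Num.min d e by rewrite lt_min d0 e0.
have [q /andP[q1 q2]] :
    exists q : rat, ratr p < (ratr q : R) < ratr p + Num.min d e.
  have lt : (ratr p : R) < ratr p + Num.min d e by lra.
  by have [q qI] := rat_in_itvoo lt; exists q; move: qI; rewrite in_itv.
have md : Num.min d e <= d by rewrite ge_min lexx.
have me : Num.min d e <= e by rewrite ge_min lexx orbT.
have : (ratr q : R) = ratr p.
  apply: sub; split; first by rewrite /= in_itv /=; apply/andP; split; lra.
  split; first by exists q.
  by apply: Hd; rewrite /ball /= ltr_norml; apply/andP; split; lra.
lra.
Qed.

Lemma xpoint_val p f g : xpoint f g p -> f (ratr p) = g (ratr p).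
Proof. by case=> e e0 /seteqP[_ /(_ (ratr p) erefl)] [_ [_]]. Qed.

Lemma xpoint_neq p f g : xpoint f g p -> f <> g.
Proof. by move=> /xpoint_not_near H e; apply: H; rewrite e; exact: filterE. Qed.

Lemma perm_trichotomy (phi : (R -> R) -> R) (v : R) F :
  perm_eq F ([seq h <- F | phi h < v] ++ [seq h <- F | phi h == v] ++
             [seq h <- F | v < phi h]).
Proof.
apply/permP => a; rewrite !count_cat !count_filter.
elim: F => //= h F ->.
by case: (ltgtP (phi h) v) => _; rewrite ?andbT ?andbF; lia.
Qed.

(** A third function through the crossing with an affine germ would cross at
    least one of [f] and [g] transversally, since it cannot coincide near [p]
    with both; properness excludes that. *)
Lemma proper_partition p F f g (v : R) :
  f (ratr p) = v -> g (ratr p) = v -> xpoint f g p ->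
  (forall h, h \in F -> h (ratr p) = v -> affine_near (ratr p) h) ->
  f \in F -> g \in F ->
  (forall h k : R -> R, h \in F -> k \in F -> meet_transversally h k p v ->
      (h = f /\ k = g) \/ (h = g /\ k = f)) ->
  count_mem f F = 1%N -> count_mem g F = 1%N ->
  perm_eq F ([seq h <- F | h (ratr p) < v] ++ [:: f; g] ++
             [seq h <- F | v < h (ratr p)]).
Proof.
move=> fv gv fg aff fF gF tr cf cg.
have neq := xpoint_neq fg.
have mid h : h \in F -> h (ratr p) = v -> h = f \/ h = g.
  move=> hF hv.
  have hfX := etrans hv (esym fv); have hgX := etrans hv (esym gv).
  have [hf|hf] := affine_germs_meet (aff h hF hv) (aff f fF fv) hfX; last first.
    by case: (tr h f hF fF (And3 hv fv hf)) => -[-> _]; [left|right].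
  have [hg|hg] := affine_germs_meet (aff h hF hv) (aff g gF gv) hgX; last first.
    by case: (tr h g hF gF (And3 hv gv hg)) => -[-> _]; [left|right].
  by case: (xpoint_not_near fg); apply: filterS2 hf hg => x <- <-.
have midE : perm_eq [seq h <- F | h (ratr p) == v] [:: f; g].
  have cnt h : count_mem h [seq h <- F | h (ratr p) == v] =
      if h (ratr p) == v then count_mem h F else 0%N.
    rewrite count_filter; case: ifP => hv.
      by apply: eq_count => k /=; case: (eqVneq k h) => // ->; rewrite hv.
    apply/eqP; rewrite -leqn0 leqNgt -has_count; apply/hasPn => k _ /=.
    by case: (eqVneq k h) => // ->; rewrite hv.
  have nfg : (f == g) = false by apply/eqP.
  have ngf : (g == f) = false by apply/eqP => e; apply: neq.
  have main h : h = f \/ h = g ->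
      count_mem h [seq h <- F | h (ratr p) == v] = count_mem h [:: f; g].
    by case=> ->; rewrite cnt ?fv ?gv eqxx ?cf ?cg /= eqxx ?nfg ?ngf.
  apply/allP => h; rewrite mem_cat => /orP hin; apply/eqP; apply: main.
  case: hin; first by rewrite mem_filter => /andP[/eqP hv hF]; exact: mid.
  by rewrite !inE => /orP[/eqP ->|/eqP ->]; [left|right].
apply: perm_trans (perm_trichotomy (fun h => h (ratr p)) v F) _.
by rewrite perm_cat2l perm_cat2r.
Qed.
End Crossing.

(** * The normal form beside an active point *)

Section NormalForm.
(* The picture at a point [x] beside an active point: the values [a] and
   [a + d] of the crossing pair, with as many values [L] below as [U] above, all
   of them out of reach of [a + d * y] for [y] bounded by [B]. *)
Variables (R : realType) (x : R) (T : nat) (a d B : R) (L U : seq R).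
Hypothesis T3 : (3 <= T)%N.
Hypothesis d0 : 0 < d.
Hypothesis B1 : 1 <= B.
Hypothesis LU : size L = size U.
Hypothesis hL : forall l, l \in L -> l <= a - B * d.
Hypothesis hU : forall u, u \in U -> a + B * d <= u.
Hypothesis Xi_split : perm_eq (values (Xi T.+1) x) (L ++ [:: a; a + d] ++ U).
Hypothesis T_odd : odd T.
Hypothesis Y_top : a < Y T.+1 x.

Lemma median_lowest : M T x = a.
Proof.
have cnt (e : pred R) : (count e (values (Xi T) x) + e (Y T.+1 x)%R =
    count e L + (e a%R + e (a + d)%R) + count e U)%N.
  have /permP/(_ e) := Xi_split.
  by rewrite values_rcons -cats1 !count_cat /= !addn0 addnA.
have sL : size L = T./2.
  by have := perm_size Xi_split; rewrite size_values !size_cat /=; lia.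
have Bd : 0 <= B * d by rewrite mulr_ge0 // ltW // (lt_le_trans _ B1).
have Ul : count (fun y => y < a) U = 0%N.
  apply/eqP; rewrite -leqn0 leqNgt -has_count; apply/hasPn => u /hU.
  by rewrite -leNgt; apply: le_trans; rewrite lerDl.
have Ll : count (fun y => y <= a) L = T./2.
  rewrite -sL; apply/eqP; rewrite -all_count.
  by apply/allP => l /hL /le_trans; apply; rewrite gerBl.
rewrite /M (median_odd (q := T./2)) ?size_values; last lia.
apply: ostat_eq; have := count_size (fun y => y < a) L.
have := cnt (fun y => y < a); have := cnt (fun y => y <= a); rewrite /nlt /nle.
rewrite Ul Ll lexx ltxx leNgt Y_top ltNge (ltW Y_top) sL /=.
by rewrite ltNge lerDl (ltW d0) /=; lia.
Qed.

Lemma median_block (g : seq R) :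
  (0 < size g)%N -> (forall y, y \in g -> `|y| <= B) ->
  median (L ++ [seq a + d * y | y <- g] ++ U) = a + d * median g.
Proof.
move=> g0 gB.
have bnd c : c \in [seq a + d * y | y <- g] -> a - B * d <= c <= a + B * d.
  case/mapP=> y /gB; rewrite ler_norml => /andP[y1 y2] ->.
  have h1 : d * (- B) <= d * y by rewrite ler_pM2l.
  have h2 : d * y <= d * B by rewrite ler_pM2l.
  by apply/andP; split; lra.
rewrite median_sandwich ?size_map //; first exact: median_affine.
- by move=> l c /hL lL /bnd /andP[c1 _]; apply: le_trans c1.
- by move=> c u /bnd /andP[_ c2] /hU; apply: le_trans.
Qed.

Lemma nf_orbitD t k : nf_orbit t (t + k) = nf_value (t + k) (nf_state R t k).
Proof. by rewrite /nf_orbit addKn. Qed.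

(** The affine map [y |-> a + d * y] conjugates the normal form to the orbit
    at [x]: by [median_block] it carries medians to medians, and the
    recursion [n * M n.-1 - n.-1 * M n.-2] commutes with affine maps because
    its coefficients add up to 1. *)
Lemma nf_invariant k :
  (forall l, (l < k)%N -> `|nf_orbit T.+2 (T.+2 + l) : R| <= B) ->
  let: (g, b, c) := nf_state R T.+2 k in
  [/\ perm_eq (values (Xi (T.+1 + k)) x) (L ++ [seq a + d * y | y <- g] ++ U),
      M (T + k) x = a + d * b, M (T.+1 + k) x = a + d * c,
      (0 < size g)%N & forall y, y \in g -> `|y| <= B] /\
  Y (T.+2 + k) x = a + d * nf_orbit T.+2 (T.+2 + k).
Proof.
elim: k => [|k IHk] yB.
  have p0 : perm_eq (values (Xi T.+1) x)
      (L ++ [seq a + d * y | y <- [:: 0; 1]] ++ U).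
    by rewrite /= mulr0 addr0 mulr1.
  have gB y : y \in [:: 0; 1] -> `|y| <= B.
    rewrite !inE => /orP[] /eqP ->; rewrite ?normr0 ?normr1 //.
    exact: le_trans B1.
  have MT1 : M T.+1 x = a + d * 2^-1.
    rewrite /M (median_perm p0) median_block // (median_even (q := 0)) //.
    by rewrite /ostat sort_le_id /= ?add0r ?div1r // ler01.
  rewrite /= !addn0; split.
    by split=> //; rewrite mulr0 addr0 median_lowest.
  rewrite Y_next_median // median_lowest MT1 /nf_orbit subnn /=.
  by rewrite -[T.+2]addn1 natrD; ring.
have {IHk} := IHk (fun l lk => yB l (ltnW lk)).
rewrite /= nf_orbitD.
have yk := yB k (ltnSn k); rewrite nf_orbitD in yk.
rewrite nf_orbitD /=.
case: (nf_state R T.+2 k) yk => [[g b] c] yk [[pk Mb Mc g0 gB] Yk].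
rewrite /nf_step; set y := nf_value _ _ in yk Yk *.
have p' : perm_eq (values (Xi (T.+1 + k).+1) x)
    (L ++ [seq a + d * z | z <- rcons g y] ++ U).
  rewrite values_rcons -addSn Yk map_rcons; apply/permP => e.
  by rewrite -!cats1 !count_cat (permP pk) !count_cat /=; lia.
have gB' z : z \in rcons g y -> `|z| <= B.
  by rewrite mem_rcons inE => /orP[/eqP -> //|]; exact: gB.
have M' : M (T.+1 + k).+1 x = a + d * median (rcons g y).
  by rewrite /M (median_perm p') median_block // size_rcons.
rewrite !addnS; split; first by split => //; rewrite ?size_rcons.
rewrite addSn Y_next_median ?M'; last lia.
by rewrite Mc /nf_value /= -[(T.+1 + k).+2]addn1 natrD; ring.
Qed.

Lemma Y_nf_orbit n : (T.+2 <= n)%N ->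
  (forall l, (T.+2 <= l < n)%N -> `|nf_orbit T.+2 l : R| <= B) ->
  Y n x = d * nf_orbit T.+2 n + a.
Proof.
move=> tn yB; rewrite -(subnKC tn); set k := (n - T.+2)%N.
have := @nf_invariant k (fun l lk => yB (T.+2 + l)%N ltac:(lia)).
by case: (nf_state _ _ _) => [[g b] c] [_ ->]; rewrite addrC.
Qed.

End NormalForm.

Section Sides.
Variable R : realType.

Lemma side_proper right (a : R) : ProperFilter (side right a).
Proof.
by case: right; [exact: at_right_proper_filter|exact: at_left_proper_filter].
Qed.

Lemma side_near right (a : R) (P : R -> Prop) :
  (\forall x \near a, P x) -> \forall x \near side right a, P x.
Proof. by case: right => H; apply: cvg_within. Qed.

Lemma orbit_bounded (t N : nat) :
  exists2 B : R, 1 <= B & forall l, (l < N)%N -> `|nf_orbit t l| <= B.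
Proof.
elim: N => [|N [B B1 HB]]; first by exists 1.
exists (Num.max B `|nf_orbit t N|); first by rewrite le_max B1.
move=> l; rewrite ltnS leq_eqVlt le_max => /orP[/eqP ->|/HB ->//].
by rewrite lexx orbT.
Qed.


(** Beside [X] the functions [Y i] and [Y j] are so close that all the
    functions [Y i + y * (Y j - Y i)] with [y] bounded stay between the lower and the
    upper functions. The neighbourhood depends on the bound alone, which is
    what stabilisation on a common neighbourhood requires. *)
Lemma nf_orbit_near (i j T : nat) (X B : R) (right : bool)
    (L U : seq (R -> R)) :
  (3 <= T)%N -> odd T ->
  perm_eq (Xi T.+1) (L ++ [:: Y i; Y j] ++ U) -> size L = size U ->
  (forall h, h \in L -> h X < Y i X) -> (forall h, h \in U -> Y i X < h X) ->
  Y j X = Y i X -> Y i X < Y T.+1 X -> 1 <= B ->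
  (\forall x \near side right X, Y i x < Y j x) ->
  \forall x \near side right X, forall n, (T.+2 <= n)%N ->
    (forall l, (T.+2 <= l < n)%N -> `|nf_orbit T.+2 l : R| <= B) ->
    Y n x = (Y j x - Y i x) * nf_orbit T.+2 n + Y i x.
Proof.
move=> T3 To part LU LX UX jX topX B1 ij; have FF := side_proper right X.
pose lo x := Y i x - B * (Y j x - Y i x).
pose hi x := Y i x + B * (Y j x - Y i x).
have ci := @Y_continuous R X i; have cj := @Y_continuous R X j.
have clo : continuous_pt X lo.
  by apply: cvgB => //; apply: cvgM; [exact: cvg_cst|exact: cvgB].
have chi : continuous_pt X hi.
  by apply: cvgD => //; apply: cvgM; [exact: cvg_cst|exact: cvgB].
have cX h : h \in L ++ [:: Y i; Y j] ++ U -> continuous_pt X h.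
  by rewrite -(perm_mem part); exact: Xi_continuous.
have H1 : \forall x \near side right X, forall h, h \in L -> h x < lo x.
  apply: (@near_seq _ _ _ L (fun h x => h x < lo x)) => h hL.
  apply/side_near/lt_near => //; first by apply: cX; rewrite mem_cat hL.
  by rewrite /lo jX subrr mulr0 subr0; exact: LX.
have H2 : \forall x \near side right X, forall h, h \in U -> hi x < h x.
  apply: (@near_seq _ _ _ U (fun h x => hi x < h x)) => h hU.
  apply/side_near/lt_near => //; first by apply: cX; rewrite !mem_cat hU !orbT.
  by rewrite /hi jX subrr mulr0 addr0; exact: UX.
have H3 : \forall x \near side right X, Y i x < Y T.+1 x.
  by apply/side_near/lt_near => //; exact: Y_continuous.
near=> x => n tn nB.
have ltij : Y i x < Y j x by near: x.
have h1 : forall h, h \in L -> h x < lo x by near: x.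
have h2 : forall h, h \in U -> hi x < h x by near: x.
have h3 : Y i x < Y T.+1 x by near: x.
set d := Y j x - Y i x; have d0 : 0 < d by rewrite subr_gt0.
have perm_x : perm_eq (values (Xi T.+1) x)
    (values L x ++ [:: Y i x; Y i x + d] ++ values U x).
  have -> : Y i x + d = Y j x by rewrite /d; lra.
  by have := perm_map (fun h : R -> R => h x) part; rewrite !map_cat.
have hL l : l \in values L x -> l <= Y i x - B * d.
  by case/mapP=> h /h1 + ->; exact: ltW.
have hU u : u \in values U x -> Y i x + B * d <= u.
  by case/mapP=> h /h2 + ->; exact: ltW.
have sLU : size (values L x) = size (values U x) by rewrite !size_map.
exact: (Y_nf_orbit T3 d0 B1 sLU hL hU perm_x To h3 tn nB).
Unshelve. all: by end_near.
Qed.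

(** At odd [T] the limit [v] is itself a value of the bundle at [p], so it
    cannot lie strictly inside the gap above [Y i] that activity provides. *)
Lemma active_xpoint_value (i j T : nat) (p : rat) : (3 <= T)%N -> odd T ->
  tau (ratr p : R) = Some T.+2 -> active_xpoint R i j p ->
  Y i (ratr p) = Y T.+2 (ratr p) :> R.
Proof.
move=> T3 To tauE [_ _ _ _ [f [_ fgap fm]]]; set X : R := ratr p.
have [cst _] := tauP tauE; have [MTX _] := median_T T3 tauE.
rewrite /bundle_at -/X tauE /= in fgap; rewrite -/X (m_constant_from cst) in fm.
rewrite -/X in MTX; set v := Y T.+2 X in fm MTX *.
have [q qE] : exists q, T = q.*2.+1 by exists T./2; lia.
have qs : (q < size (values (Xi T) X))%N by rewrite size_values; lia.
have qv : ostat (values (Xi T) X) q = v.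
  by rewrite -MTX /M (median_odd (q := q)) ?size_values.
have v_in : v \in values (Xi T.+1) X.
  have /andP[l1 l2] := ostat_count qs qv.
  rewrite values_rcons mem_rcons inE -count_lt_le_mem.
  by rewrite (leq_ltn_trans l1 l2) orbT.
move: fm; rewrite in_itv /= => /andP[].
rewrite le_eqVlt => /orP[/eqP //|iv vf].
have : ([set y | y \in values (Xi T.+1) X] `&` [set` `]Y i X, f X[ ]) v.
  by split=> //=; rewrite in_itv /= iv vf.
by rewrite fgap.
Qed.

End Sides.

Theorem proposition17 (R : realType) (i j : nat) (p : rat) (t : nat)
    (i_gt0 : (0 < i)%N) (j_gt0 : (0 < j)%N)
    (hp : 1 / 2 <= p <= 2 / 3)
    (hproper : proper_xpoint R i j p) (hactive : active_xpoint R i j p)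
    (htau : tau (ratr p : R) = Some t) (ht : (5 <= t)%N) :
  odd t /\
  forall right : bool,
    (\forall x \near side right (ratr p : R), Y i x < Y j x) ->
    (forall n, (t <= n)%N -> \forall x \near side right (ratr p : R),
       Y n x = (Y j x - Y i x) * nf_orbit t n + Y i x) /\
    (stabilises_near (side right (ratr p : R)) t (@Y R) <->
     stabilises t (@nf_orbit R t)).
Proof.
case: t htau ht => [//|[//|T]] htau ht; have T3 : (3 <= T)%N by [].
have act := hactive; set X : R := ratr p in htau *.
have pb : 1 / 2 <= X < 1.
  case/andP: hp => p1 p2; apply/andP; split.
    have -> : 1 / 2 = ratr (1 / 2) :> R.
      by rewrite fmorph_div /= rmorph1 rmorph_nat.
    by rewrite ler_rat.
  have -> : 1 = ratr 1 :> R by rewrite rmorph1.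
  by rewrite ltr_rat; lra.
case: hproper => xp _ _ tr [ci cj]; case: hactive => _ _ mono [Yi Yj] _.
rewrite /bundle_at -/X htau /= in tr ci cj Yi Yj.
have {}mono : forall n, (3 <= n)%N -> M n X <= M n.+1 X := nbhs_singleton mono.
have To := T_odd T3 htau pb mono.
have nlt_v := nlt_T T3 htau pb mono.
have Ytop := next_T_gt T3 htau pb mono.
have YiX := active_xpoint_value T3 To htau act; rewrite -/X in YiX.
have YjX : Y j X = Y T.+2 X by rewrite -(xpoint_val xp).
have aff h : h \in Xi T.+1 -> h X = Y T.+2 X -> affine_near X h.
  rewrite XiE => /mapP[k]; rewrite mem_iota => kT -> kv.
  apply: (affine_near_Y T3 htau pb mono).
  apply: (le_v_index T3 htau pb mono); first by lia.
  by rewrite kv.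
rewrite YiX in tr.
have part := proper_partition YiX YjX xp aff Yi Yj tr ci cj.
set Lf := [seq h <- _ | _ < _] in part; set Uf := [seq h <- _ | _ < _] in part.
have sL : size Lf = T./2 by rewrite size_filter -nlt_v /nlt /values count_map.
have sLU : size Lf = size Uf.
  by have := perm_size part; rewrite !size_cat size_Xi sL /=; lia.
split; first by rewrite /= negbK.
move=> right ij; have FF := side_proper right X.
have unif (B : R) (B1 : 1 <= B) : \forall x \near side right X,
    forall n, (T.+2 <= n)%N ->
    (forall l, (T.+2 <= l < n)%N -> `|nf_orbit T.+2 l : R| <= B) ->
    Y n x = (Y j x - Y i x) * nf_orbit T.+2 n + Y i x.
  apply: (nf_orbit_near T3 To part sLU) => //.
  - by move=> h; rewrite mem_filter YiX => /andP[].
  - by move=> h; rewrite mem_filter YiX => /andP[].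
  - by rewrite YiX YjX.
  - by rewrite YiX.
have formula n : (T.+2 <= n)%N -> \forall x \near side right X,
    Y n x = (Y j x - Y i x) * nf_orbit T.+2 n + Y i x.
  move=> tn; have [B B1 HB] := orbit_bounded R T.+2 n.
  by apply: filterS (unif B B1) => x; apply=> // l /andP[_]; exact: HB.
split=> //; split=> -[N tN HN]; exists N => //.
  move=> n Nn; have Hn := formula n (leq_trans tN Nn).
  have [x [[x1 x4] [x2 x3]]] :=
    filter_ex (filterI (filterI HN ij) (filterI Hn (formula N tN))).
  have := x1 n Nn; rewrite x2 x3 => /addIr; apply: mulfI.
  by rewrite subr_eq0 gt_eqF.
(* An eventually constant orbit is bounded, so one neighbourhood serves all
   indices. *)
have [B B1 HB] := orbit_bounded R T.+2 N.+1.
apply: filterS (unif B B1) => x H n Nn.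
have bnd l : `|nf_orbit T.+2 l : R| <= B.
  by case: (leqP l N) => [lN|/ltnW /HN ->]; apply: HB.
by rewrite (H n (leq_trans tN Nn)) // (H N tN) // HN.
Qed.
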